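(* For all sufficiently large $n$, every real polynomial $P$ in $n$ variables of degree at most $\frac{\log n}{15\log\log n}$ satisfies $\mathrm{Cor}_n(\mathrm{par}_n,P)\le 0$.
   Context: $\mathrm{par}_n:\{0,1\}^n\to\{0,1\}$ is the parity function, $\mathrm{par}_n(x)=x_1+x_2+\cdots+x_n \bmod 2$. For functions $f,g:\{0,1\}^n\to\mathbb{R}$, $\mathrm{Cor}_n(f,g)=\mathbf{P}_x(f(x)=g(x))-\tfrac12$, where $x$ is uniformly distributed over $\{0,1\}^n$; a real polynomial $P$ is regarded as a function on $\{0,1\}^n$ by restriction. $\log$ is the natural logarithm. *)

(* Defs.v *)
From mathcomp Require Import all_boot all_order all_algebra.
From mathcomp Require Import mpoly reals.

Set Implicit Arguments.
Unset Strict Implicit.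
Unset Printing Implicit Defensive.

Import Order.TTheory GRing.Theory Num.Theory.
Local Open Scope ring_scope.

Definition cube (n : nat) : finType := {ffun 'I_n -> bool}.

Definition par (n : nat) (x : cube n) : nat :=
  ((\sum_(i < n) x i) %% 2)%N.

Definition unif_prob (R : realType) (n : nat) (A : {set cube n}) : R :=
  #|A|%:R / #|cube n|%:R.

Definition Cor (R : realType) (n : nat) (f g : cube n -> R) : R :=
  unif_prob R [set x | f x == g x] - 2^-1.

Definition cube_restr (R : realType) (n : nat) (P : {mpoly R[n]}) :
    cube n -> R :=
  fun x => P.@[fun i => (x i)%:R].

(* msize is one more than the total degree, and 0 for the zero polynomial,
   which thus gets degree 0 here. *)
Definition total_degree (R : realType) (n : nat) (P : {mpoly R[n]}) : nat :=
  (msize P).-1.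

(* Main.v *)
Require Import Defs.
From mathcomp Require Import all_boot all_order all_algebra.
From mathcomp Require Import reals sequences exp.
From mathcomp Require Import ring lra zify.
From mathcomp Require mpoly.

(** Let d = deg P, and let M be the number of subsets of [n] whose size lies in
    a suitable window of at most d + 1 middle sizes, so M = O(d 2^n / sqrt n).
    - If f has degree d and no zero on the cube, then sgn f agrees with
      (-1)^par in at most (2^n + M) / 2 points (Aspnes, Beigel, Furst, Rudich):
      otherwise some g <> 0 of degree about (n - d) / 2 vanishes on all the
      errors, and sum_x (-1)^par(x) f(x) g(x)^2 = 0 is a sum of nonnegative
      terms, not all zero.
    - Since 2 [f = 0] = sgn (f + e) + sgn (- f + e) for small e > 0, the sum of
      (-1)^par over the zeros of f is at most M in absolute value.
    - Applied to P and P - 1, this gives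
      2 #{P = par} <= #{P in {0,1}} + 2 M.
    - If P is not Boolean-valued, P (P - 1) has degree 2 d and is not zero, hence
      is nonzero in at least 2^(n - 2d) points, and this is at least 2 M as soon
      as 4 * 64^d <= n. If P is Boolean-valued, orthogonality of 1 - 2 P to (-1)^par gives exact
      agreement 1/2. *)

Set Implicit Arguments.
Unset Strict Implicit.
Unset Printing Implicit Defensive.

Import Order.TTheory GRing.Theory Num.Theory.

(** * Bounds on binomial coefficients *)

(** Induction: from [m] to [m+1] the central coefficient grows by the factor [2(2m+1)/(m+1)], and
    [(2m+1)(2m+3) <= 4(m+1)^2]. *)
Lemma sqr_central_bin_le m : ('C(m.*2, m) ^ 2 * m.*2.+1 <= 16 ^ m)%N.
Proof.
elim: m => [//|m IH].
have step : (m.+1 * 'C(m.+1.*2, m.+1) = 2 * m.*2.+1 * 'C(m.*2, m))%N.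
  have h1 := mul_bin_diag m.*2.+2 m; have h2 := mul_bin_down m.*2.+1 m.
  rewrite /= in h1 h2; rewrite doubleS.
  have e : (m.*2.+1 - m = m.+1)%N by lia.
  rewrite e in h2.
  have := congr1 (muln m.+1) h1; nia.
rewrite -(@leq_pmul2l (m.+1 ^ 2)) // mulnA -expnMn step (expnS 16).
rewrite doubleS !expnMn.
set c := ('C(m.*2, m) ^ 2)%N in IH *; set p := (16 ^ m)%N in IH *.
have -> : (2 ^ 2 * m.*2.+1 ^ 2 * c * m.*2.+3 =
  4 * m.*2.+1 * m.*2.+3 * (c * m.*2.+1))%N by ring.
apply: (leq_trans (leq_mul (leqnn _) IH)).
rewrite mulnA leq_mul2r; apply/orP; right; lia.
Qed.

Lemma leq_bin_central n i : ('C(n, i) <= 'C(n, n./2))%N.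
Proof.
have up j : (j.+1 <= n./2)%N -> ('C(n, j) <= 'C(n, j.+1))%N.
  move=> jn; have := mul_bin_left n j => e.
  rewrite -(@leq_pmul2l j.+1) // e leq_mul2r; apply/orP; right; lia.
have mono a b : (a + b <= n./2)%N -> ('C(n, a) <= 'C(n, a + b))%N.
  elim: b => [|b IH] ab; first by rewrite addn0.
  by rewrite addnS in ab *; apply: leq_trans (IH (ltnW ab)) (up _ ab).
have low a : (a <= n./2)%N -> ('C(n, a) <= 'C(n, n./2))%N.
  by move=> an; have := mono a (n./2 - a)%N; rewrite subnKC //; apply.
have [/low //|ni] := leqP i n./2.
have [lein|ltni] := leqP i n; last by rewrite bin_small.
by rewrite -bin_sub //; apply: low; lia.
Qed.

(** For odd [n = 2m+1], ['C(2m+2, m+1) = 2 'C(2m+1, m)] reduces the bound to the central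
    coefficient. *)
Lemma sqr_bin_le n i : ('C(n, i) ^ 2 * n <= 4 ^ n)%N.
Proof.
apply: (@leq_trans ('C(n, n./2) ^ 2 * n)).
  by rewrite leq_mul2r leq_sqr leq_bin_central orbT.
have e16 m : (16 ^ m = 4 ^ m.*2)%N by rewrite -mul2n expnM.
have := odd_double_half n; set m := n./2; case: (odd n) => /= <-; rewrite ?add0n ?add1n.
- have e : ('C(m.+1.*2, m.+1) = 2 * 'C(m.*2.+1, m))%N.
    by have := mul_bin_diag m.*2.+2 m; rewrite doubleS /=; nia.
  have := sqr_central_bin_le m.+1.
  rewrite e e16 doubleS expnMn !(expnS 4).
  set c := ('C(_, _) ^ 2)%N; nia.
- have := sqr_central_bin_le m; rewrite e16; apply: leq_trans.
  by rewrite leq_mul2l leqnSn orbT.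
Qed.

(** * Counting the middle layers *)

Lemma card_set_finType (V : finType) : #|{set V}| = (2 ^ #|V|)%N.
Proof. by rewrite -[in LHS]cardsT -powersetT card_powerset cardsT. Qed.

(** The sets of size at most [k] and their complements leave only the [#|V| - 2k - 1] sizes strictly
    between [k] and [#|V| - k]. *)
Lemma card_middle_layers (V : finType) k b : (k.*2 < #|V|)%N ->
    (forall i, 'C(#|V|, i) <= b)%N ->
  (2 ^ #|V| <= 2 * #|[set S : {set V} | #|S| <= k]| + (#|V| - k.*2.+1) * b)%N.
Proof.
move=> kn binb.
set L := [set S : {set V} | _].
have cardU : #|~: (L :|: [set ~: S | S in L])| + #|L| + #|L| >= 2 ^ #|V|.
  rewrite -card_set_finType -(cardsC (L :|: [set ~: S | S in L])) addnC -addnA leq_add2l.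
  rewrite (leq_trans (leq_card_setU _ _)) // leq_add2l leq_imset_card //.
suff : (#|~: (L :|: [set ~: S | S in L])| <= (#|V| - k.*2.+1) * b)%N by lia.
have sub : ~: (L :|: [set ~: S | S in L]) \subset
    \bigcup_(i < #|V| - k.*2.+1) [set S : {set V} | #|S| == k.+1 + i].
  apply/subsetP => S; rewrite !inE negb_or => /andP[kS hS].
  have Sk : (#|~: S| > k)%N.
    rewrite ltnNge; apply: contraNN hS => ck; apply/imsetP.
    by exists (~: S); rewrite ?inE // setCK //.
  have cS := cardsC S.
  have iP : (#|S| - k.+1 < #|V| - k.*2.+1)%N by lia.
  by apply/bigcupP; exists (Ordinal iP) => //; rewrite inE /=; apply/eqP; lia.
apply: leq_trans (subset_leq_card sub) _.
apply: (@leq_trans (\sum_(i < #|V| - k.*2.+1) b));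
  last by rewrite sum_nat_const card_ord.
elim/big_ind2: _ => [|A a B c Aa Bc|i _]; first by rewrite cards0.
  by apply: leq_trans (leq_card_setU _ _) _; apply: leq_add.
by rewrite card_draws.
Qed.

(** * Degree on the cube and orthogonality to parity *)

Local Open Scope ring_scope.

(* A point of the cube is encoded by the set of its coordinates equal to 1. *)
Definition set_sign (R : realFieldType) (V : finType) (X : {set V}) : R :=
  (-1) ^+ #|X|.

(* The function [X |-> (S \subset X)] is the multilinear monomial of [S]. *)
Definition sdeg_le (R : realFieldType) (V : finType) (d : nat)
    (f : {set V} -> R) : Prop :=
  exists c : {set V} -> R, (forall S : {set V}, (d < #|S|)%N -> c S = 0) /\
    forall X, f X = \sum_(S : {set V} | S \subset X) c S.

Section SetFunctions.
Context {R : realFieldType} {V : finType}.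
Implicit Types (a : R) (f g h : {set V} -> R) (d e : nat) (X S T : {set V}).

(** Toggling [i] flips the sign and preserves [h], so the terms cancel in pairs. *)
Lemma alternating_sum0 (S : {set V}) (i : V) h :
    i \in S -> (forall X, h (i |: X) = h (X :\ i)) ->
  \sum_(X : {set V} | X \subset S) set_sign R X * h X = 0.
Proof.
move=> iS hi.
rewrite (bigID (fun X : {set V} => i \in X)) /=.
rewrite (reindex_onto (fun X => i |: X) (fun X => X :\ i)) /=; last first.
  by move=> X /andP[_ iX]; rewrite setD1K.
rewrite -[X in X + _]opprK addrC; apply/eqP; rewrite subr_eq0; apply/eqP.
rewrite -sumrN; apply: eq_big => [X | X /andP[_ iX]].
  rewrite setU11 andbT subUset sub1set iS /=; congr (_ && _).
  by apply/idP/eqP => [/setU1K // | <-]; rewrite !inE eqxx.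
rewrite /set_sign cardsU1 iX exprS mulN1r mulNr opprK hi.
by congr (_ * h _); apply/esym/setDidPl; rewrite disjoint_sym disjoints1.
Qed.

Lemma eq_sdeg_le d f g : f =1 g -> sdeg_le d f -> sdeg_le d g.
Proof. by move=> fg [c [c0 cE]]; exists c; split=> // X; rewrite -fg. Qed.

Lemma sdeg_le_monomial d S a : (#|S| <= d)%N ->
  sdeg_le d (fun X : {set V} => a * (S \subset X)%:R).
Proof.
move=> Sd; exists (fun T => if T == S then a else 0); split=> [T|X].
  by case: eqP => [->|//]; rewrite ltnNge Sd.
rewrite -big_mkcondr /=; case: (boolP (S \subset X)) => SX.
  rewrite (big_pred1 S) ?mulr1 // => T /=.
  by rewrite andbC; case: eqP => // ->.
rewrite big1 ?mulr0 // => T /andP[TX /eqP TS]; by rewrite -TS TX in SX.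
Qed.

Lemma sdeg_le_cst d a : sdeg_le d (fun _ : {set V} => a).
Proof.
apply: (@eq_sdeg_le _ (fun X => a * (set0 \subset X)%:R)) => [X|].
  by rewrite sub0set mulr1.
by apply: sdeg_le_monomial; rewrite cards0.
Qed.

Lemma sdeg_leD d f g : sdeg_le d f -> sdeg_le d g ->
  sdeg_le d (fun X => f X + g X).
Proof.
move=> [a [a0 aE]] [b [b0 bE]]; exists (fun S => a S + b S); split=> [S dS|X].
  by rewrite a0 // b0 // addr0.
by rewrite aE bE big_split.
Qed.

Lemma sdeg_le_sum d (I : Type) (r : seq I) (F : I -> {set V} -> R) :
  (forall i, sdeg_le d (F i)) -> sdeg_le d (fun X => \sum_(i <- r) F i X).
Proof.
move=> dF; elim: r => [|i r IH].
  by apply: (eq_sdeg_le _ (sdeg_le_cst d 0)) => X; rewrite big_nil.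
by apply: (eq_sdeg_le _ (sdeg_leD (dF i) IH)) => X; rewrite big_cons.
Qed.

(** On the cube the monomials of [S] and [T] multiply to that of [S :|: T]. *)
Lemma sdeg_leM d e f g : sdeg_le d f -> sdeg_le e g ->
  sdeg_le (d + e) (fun X => f X * g X).
Proof.
move=> [a [a0 aE]] [b [b0 bE]].
exists (fun U => \sum_(p : {set V} * {set V} | p.1 :|: p.2 == U) a p.1 * b p.2).
split=> [U dU|X].
  apply: big1 => -[S T] /= /eqP STU.
  have [dS|Sd] := ltnP d #|S|; first by rewrite a0 // mul0r.
  have [eT|Te] := ltnP e #|T|; first by rewrite b0 // mulr0.
  have := leq_card_setU S T; rewrite STU => /(leq_trans dU).
  by rewrite ltnNge leq_add.
rewrite aE bE big_distrlr /= pair_big_dep /=.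
rewrite (partition_big (fun p : {set V} * {set V} => p.1 :|: p.2)
  (fun U : {set V} => U \subset X)) /= => [|[S T] /=]; last by rewrite subUset.
apply: eq_bigr => U UX; apply: eq_bigl => -[S T] /=.
by case: eqP => [STU|]; rewrite ?andbF // -subUset STU UX.
Qed.

Lemma sdeg_leN d f : sdeg_le d f -> sdeg_le d (fun X => - f X).
Proof.
by move/(sdeg_leM (sdeg_le_cst 0 (-1))); apply: eq_sdeg_le => X; rewrite mulN1r.
Qed.

(** Every monomial that occurs misses some coordinate, and toggling it cancels the sum. *)
Lemma sign_sum0 d f : sdeg_le d f -> (d < #|V|)%N ->
  \sum_X set_sign R X * f X = 0.
Proof.
move=> [c [c0 cE]] dn.
under eq_bigr do rewrite cE mulr_sumr big_mkcond /=.
rewrite exchange_big big1 //= => T _.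
have [dT|Td] := ltnP d #|T|.
  by apply: big1 => X _; rewrite c0 // mulr0 if_same.
have [i _ iT] : exists2 i, i \in [set: V] & i \notin T.
  by apply/subsetPn; rewrite subTset; apply/eqP => TV; move: dn;
  rewrite -cardsT -TV ltnNge Td.
rewrite (eq_bigr (fun X => set_sign R X * (c T * (T \subset X)%:R))); last first.
  by move=> X _; case: ifP => _; rewrite ?mulr1 ?mulr0.
rewrite -[RHS](@alternating_sum0 setT i (fun X => c T * (T \subset X)%:R)) ?inE //.
  by apply: eq_bigl => X; rewrite subsetT.
move=> X; have -> : X :\ i = (i |: X) :\ i by rewrite setDUl setDv set0U.
by rewrite subsetD1 iT andbT.
Qed.

(** * Supports of functions of low degree *)

(* If [S] is maximal in the support of [c], the alternating sum of [f] over any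
   translate of the subcube of [S] is [c S] up to sign, so [f] does not vanish
   on it. *)
Lemma card_support_maximal (c : {set V} -> R) f S :
    (forall X, f X = \sum_(T : {set V} | T \subset X) c T) -> c S != 0 ->
    (forall T, S \proper T -> c T = 0) ->
  (2 ^ #|V| <= #|[set X | f X != 0%R]| * 2 ^ #|S|)%N.
Proof.
move=> fE cS maxS.
have subcube (Y : {set V}) : Y \subset ~: S ->
    exists2 Z : {set V}, Z \subset S & f (Y :|: Z) != 0.
  move=> YS.
  have Efc : \sum_(Z : {set V} | Z \subset S) set_sign R Z * f (Y :|: Z) =
      set_sign R S * c S.
    under eq_bigr do rewrite fE mulr_sumr big_mkcond /=.
    (* Only [T = S] contributes, through [Z = S]: for [T] strictly above [S] the coefficient is
       zero, and any other [T] misses some [i] in [S], which can be toggled. *)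
    rewrite exchange_big (bigD1 S) //= [X in _ + X]big1 => [|T TS].
      rewrite (bigD1 S) //= subsetUr big1 ?addr0 // => Z /andP[ZS ZnS].
      rewrite ifF //; apply: contraNF ZnS => SYZ; rewrite eqEsubset ZS /=.
      apply/subsetP => x xS; move/subsetP/(_ x xS): SYZ; rewrite inE => /orP[] //.
      by move=> /(subsetP YS); rewrite inE xS.
    rewrite (eq_bigr (fun Z => set_sign R Z * (c T * (T \subset Y :|: Z)%:R)));
      last by move=> Z _; case: ifP => _; rewrite ?mulr1 ?mulr0.
    have [ST|/subsetPn[i iS iT]] := boolP (S \subset T).
      rewrite big1 // => Z _; rewrite maxS ?mul0r ?mulr0 //.
      by rewrite properEneq eq_sym TS.
    apply: (@alternating_sum0 S i (fun Z => c T * (T \subset Y :|: Z)%:R)) => // Z.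
    have addi (W : {set V}) : (T \subset W) = (T \subset W :\ i).
      by rewrite subsetD1 iT andbT.
    rewrite addi [in RHS]addi.
    suff -> : (Y :|: (i |: Z)) :\ i = (Y :|: Z :\ i) :\ i by [].
    by apply/setP => x; rewrite !inE; case: (x == i).
  have [/existsP[Z /andP[ZS fZ]]|/existsPn allz] :=
      boolP [exists Z : {set V}, (Z \subset S) && (f (Y :|: Z) != 0)].
    by exists Z.
  move: Efc; rewrite big1 => [/esym/eqP|Z ZS].
    by rewrite mulf_eq0 signr_eq0 (negbTE cS).
  by have := allz Z; rewrite ZS negbK => /eqP ->; rewrite mulr0.
(* By [subcube], removing [S] maps the support of [f] onto all subsets of [~: S]. *)
rewrite -(cardsC S) addnC expnD leq_mul2r; apply/orP; right.
rewrite -card_powerset.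
apply: (@leq_trans #|[set X :\: S | X in [set X | f X != 0%R]]|);
  last exact: leq_imset_card.
apply/subset_leq_card/subsetP => Y; rewrite inE => YS.
have [Z ZS fZ] := subcube Y YS; apply/imsetP; exists (Y :|: Z); rewrite ?inE //.
apply/setP => x; rewrite !inE.
have := subsetP YS x; have := subsetP ZS x; rewrite inE.
by case: (x \in S) (x \in Y) (x \in Z) => -[] [] //= ZS' YS';
  [move: (YS' isT) | move: (YS' isT) | move: (ZS' isT)].
Qed.

Lemma exists_maximal_support (c : {set V} -> R) S : c S != 0 ->
  exists2 T : {set V}, c T != 0 & forall U : {set V}, T \proper U -> c U = 0.
Proof.
move=> cS; have [T /maxsetP[cT maxT] _] :=
  maxset_exists (P := fun T : {set V} => c T != 0) cS.
exists T => // U TU; apply/eqP/negPn/negP => cU.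
by have := TU; rewrite (maxT U cU (proper_sub TU)) properxx.
Qed.

(** The analogue of the minimum distance of Reed-Muller codes: a maximal set in the support of [c]
    has size at most [d]. *)
Lemma card_support_sdeg_le d f X : sdeg_le d f -> f X != 0 ->
  (2 ^ #|V| <= #|[set X | f X != 0%R]| * 2 ^ d)%N.
Proof.
move=> [c [c0 fE]] fX.
have [S cS] : exists S : {set V}, c S != 0.
  apply/existsP; apply: contraNT fX => /existsPn c00; rewrite fE big1 // => T _.
  by apply/eqP/negPn.
have [T cT maxT] := exists_maximal_support cS.
apply: leq_trans (card_support_maximal fE cT maxT) _.
rewrite leq_mul2l leq_pexp2l ?orbT //.
by rewrite leqNgt; apply: contraNN cT => /c0 ->.
Qed.

(** * Sign errors and zeros against parity *)

(** Linear algebra: vanishing on [E] imposes fewer equations than there are coefficients of degree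
    at most [k]. *)
Lemma exists_vanishing k (E : {set {set V}}) :
    (#|E| < #|[set S : {set V} | #|S| <= k]|)%N ->
  exists g, [/\ sdeg_le k g, forall X : {set V}, X \in E -> g X = 0 &
    exists X : {set V}, g X != 0].
Proof.
set D := [set S : {set V} | _] => ED.
pose M : 'M[R]_(#|D|, #|E|) :=
  \matrix_(i, j) ((enum_val i : {set V}) \subset (enum_val j : {set V}))%:R.
have [i Mi] : exists i, row i (kermx M) != 0.
  apply/existsP; apply: contraLR ED => /existsPn ker0; rewrite -leqNgt.
  have : kermx M == 0.
    apply/eqP/row_matrixP => i; rewrite row0; exact/eqP/negPn.
  rewrite kermx_eq0 /row_free => /eqP <-; exact: rank_leq_col.
have := sub_kermxP (row_sub i (kermx M)).
move: (row i (kermx M)) Mi => u u_neq0 uM.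
have [j uj] : exists j, u 0 j != 0.
  apply/existsP; apply: contraNT u_neq0 => /existsPn u0; apply/eqP/rowP => j.
  by rewrite [RHS]mxE; apply/eqP/negPn.
pose c (S : {set V}) := \sum_(j < #|D|) (if S == enum_val j then u 0 j else 0).
have cE j' : c (enum_val j') = u 0 j'.
  rewrite /c (bigD1 j') //= eqxx big1 ?addr0 // => j2 /negbTE nj.
  by rewrite (inj_eq enum_val_inj) eq_sym nj.
have c0 S : (k < #|S|)%N -> c S = 0.
  move=> kS; apply: big1 => j' _; case: eqP => // Sj; have := enum_valP j'.
  by rewrite -Sj inE leqNgt kS.
exists (fun X => \sum_(S : {set V} | S \subset X) c S); split.
- by exists c.
- move=> X XE; move/matrixP/(_ 0 (enum_rank_in XE X)): uM; rewrite !mxE => uM.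
  rewrite exchange_big -[RHS]uM /=; apply: eq_bigr => j' _.
  rewrite mxE enum_rankK_in // -big_mkcondr /=.
  case: (boolP (_ \subset _)) => jX.
    rewrite mulr1 (big_pred1 (enum_val j')) // => S /=.
    by rewrite andbC; case: eqP => // ->.
  rewrite mulr0 big1 // => S /andP[SX /eqP Sj]; by rewrite -Sj SX in jX.
(* A nonzero coefficient family gives a nonzero function, by the support bound at a maximal set. *)
have cj : c (enum_val j) != 0 by rewrite cE.
have [T cT maxT] := exists_maximal_support cj.
have := card_support_maximal (fun=> erefl) cT maxT.
case: (set_0Vmem
  [set X : {set V} | \sum_(S : {set V} | S \subset X) c S != 0]) => [->|[X]].
  by rewrite cards0 mul0n leqn0 expn_eq0.
by rewrite inE; exists X.
Qed.

(** With fewer errors, some nonzero [g] of degree at most [k] would vanish on them all; [f * g^2]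
    has degree at most [d + 2k < #|V|], so its signed sum is zero. *)
Lemma leq_card_sign_errors d k f : sdeg_le d f -> (forall X, f X != 0) ->
    (d + k.*2 < #|V|)%N ->
  (#|[set S : {set V} | #|S| <= k]| <= #|[set X | (set_sign R X * f X < 0)%R]|)%N.
Proof.
move=> df f0 dk; rewrite leqNgt; apply/negP => /exists_vanishing[g [kg gE [X gX]]].
have := sign_sum0 (sdeg_leM df (sdeg_leM kg kg)); rewrite addnn => /(_ dk) sum0.
have nneg Y : true -> 0 <= set_sign R Y * (f Y * (g Y * g Y)).
  move=> _; have [neg|] := ltP (set_sign R Y * f Y) 0.
    by rewrite gE ?inE // !mulr0.
  by move=> pos; rewrite mulrA mulr_ge0 // -expr2 sqr_ge0.
have /eqP := psumr_eq0P nneg sum0 (i := X) isT.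
by rewrite !mulf_eq0 signr_eq0 (negbTE (f0 X)) (negbTE gX).
Qed.

(** Each term is [-1] at an error and [1] elsewhere. *)
Lemma sign_sgr_sum_le d k f : sdeg_le d f -> (forall X, f X != 0) ->
    (d + k.*2 < #|V|)%N ->
  \sum_X set_sign R X * Num.sg (f X) <=
    2 ^+ #|V| - 2 * #|[set S : {set V} | (#|S| <= k)%N]|%:R.
Proof.
move=> df f0 dk; have := leq_card_sign_errors df f0 dk.
rewrite -(ler_nat R) -[X in _ <= X%:R -> _]sum1dep_card natr_sum big_mkcond /= => errs.
have -> : \sum_X set_sign R X * Num.sg (f X) =
    \sum_(X : {set V}) (1 - 2 * (if set_sign R X * f X < 0 then 1 else 0)).
  apply: eq_bigr => X _; have := f0 X; rewrite /set_sign -signr_odd.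
  by case: odd; rewrite ?expr0 ?expr1 ?mulN1r ?mul1r ?oppr_lt0;
    case: sgrP => //= _ _; ring.
rewrite sumrB -mulr_sumr sumr_const card_set_finType.
rewrite natrX; lra.
Qed.

Lemma sign_zero_sum_le d k f : sdeg_le d f -> (d + k.*2 < #|V|)%N ->
  `|\sum_X set_sign R X * (f X == 0)%:R| <=
    2 ^+ #|V| - 2 * #|[set S : {set V} | (#|S| <= k)%N]|%:R.
Proof.
move=> df dk; set M := (X in _ <= X).
(* [e] is half the least nonzero [|f X|]; the initial value [1] of the minimum keeps it positive
   even if [f] is zero. *)
have [e e_gt0 eP] : exists2 e : R, 0 < e & forall X, f X != 0 -> e < `|f X|.
  pose m := \big[Order.min/1]_(X | f X != 0) `|f X|.
  have m0 : 0 < m.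
    apply: (big_ind (fun x => 0 < x)) => // [x y x0 y0|X fX];
      by rewrite ?lt_min ?x0 ?normr_gt0.
  exists (m / 2) => [|X fX]; first lra.
  have : m <= `|f X| by rewrite /m (bigD1 X) //= ge_min lexx.
  lra.
(* The two values of [s] give the two sides of the absolute value; [s [f = 0]] is the mean of the
   signs of [f + s e] and [- f + s e]. *)
have half s : s = 1 \/ s = -1 ->
    s * \sum_X set_sign R X * (f X == 0)%:R <= M.
  move=> s1.
  have sE X : s * (set_sign R X * (f X == 0)%:R) =
      2^-1 * (set_sign R X * Num.sg (f X + s * e)) +
      2^-1 * (set_sign R X * Num.sg (- f X + s * e)).
    have [->|fX] := eqVneq (f X) 0.
      by case: s1 => ->; rewrite oppr0 !add0r ?mulN1r ?mul1r ?sgrN gtr0_sg //=;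
        field.
    have := eP X fX; rewrite /= !mulr0.
    have [fX0|fX0] := ltrP 0 (f X).
      rewrite gtr0_norm // => eX; rewrite gtr0_sg ?ltr0_sg; first ring.
      - by case: s1 => ->; lra.
      - by case: s1 => ->; lra.
    rewrite ler0_norm // => eX; rewrite ltr0_sg ?gtr0_sg; first ring.
    - by case: s1 => ->; lra.
    - by case: s1 => ->; lra.
  have ne X : f X + s * e != 0 /\ - f X + s * e != 0.
    have [->|/(eP X)] := eqVneq (f X) 0.
      by split; apply/eqP; case: s1 => ->; lra.
    have [fX0|fX0] := ltrP 0 (f X); [rewrite gtr0_norm //|rewrite ler0_norm //];
      by move=> eX; split; apply/eqP; case: s1 => ->; lra.
  have dse := sdeg_le_cst d (s * e).
  have := sign_sgr_sum_le (sdeg_leD df dse) (fun X => (ne X).1) dk.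
  have := sign_sgr_sum_le (sdeg_leD (sdeg_leN df) dse) (fun X => (ne X).2) dk.
  rewrite -/M mulr_sumr (eq_bigr _ (fun X _ => sE X)) big_split /= -!mulr_sumr.
  lra.
rewrite ler_norml; apply/andP; split.
  by have := half (-1) (or_intror erefl); lra.
by have := half 1 (or_introl erefl); lra.
Qed.

(** * Counting agreements with parity *)

Lemma sum_natr_card (P : pred {set V}) :
  \sum_X (P X)%:R = #|[set X | P X]|%:R :> R.
Proof.
rewrite -sum1dep_card natr_sum [in RHS]big_mkcond.
by apply: eq_bigr => X _; case: (P X).
Qed.

(* The pointwise identity behind the count: a point where [f] is [0] or [1]
   contributes to the two sums with the sign of its agreement with parity. *)
Lemma parity_agreementE f :
  2 * #|[set X | f X == (odd #|X|)%:R]|%:R =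
    2 ^+ #|V| - #|[set X | f X * (f X - 1) != 0%R]|%:R +
    (\sum_X set_sign R X * (f X == 0)%:R -
     \sum_X set_sign R X * (f X - 1 == 0)%:R).
Proof.
have -> : 2 ^+ #|V| = \sum_(X : {set V}) 1 :> R.
  by rewrite sumr_const card_set_finType natrX.
rewrite -!sum_natr_card mulr_sumr -!sumrB -big_split /=; apply: eq_bigr => X _.
rewrite /set_sign -signr_odd mulf_eq0 subr_eq0.
have [->|f0] := eqVneq (f X) 0.
  rewrite [0 == 1]eq_sym oner_eq0; case: odd;
    by rewrite ?eqxx ?[0 == 1]eq_sym ?oner_eq0 /=; ring.
have [->|f1] := eqVneq (f X) 1.
  by case: odd; rewrite ?eqxx ?oner_eq0 /=; ring.
by case: odd; rewrite ?(negbTE f0) ?(negbTE f1) /=; ring.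
Qed.

Lemma parity_agreement_le d f : sdeg_le d f -> (4 * 64 ^ d <= #|V|)%N ->
  (2 * #|[set X | f X == (odd #|X|)%:R]| <= 2 ^ #|V|)%N.
Proof.
move=> df dn; have lt_dn : (d < #|V|)%N.
  by have := ltn_expl d (isT : (1 < 64)%N); lia.
rewrite -(ler_nat R) natrM parity_agreementE natrX.
set O := #|_|.
have df1 : sdeg_le d (fun X => f X - 1) := sdeg_leD df (sdeg_le_cst d (-1)).
have [/existsP[X fX]|/existsPn fX] :=
  boolP [exists X, f X * (f X - 1) != 0]; last first.
  (* For Boolean-valued [f], [[f = 0] - [f = 1] = - f - (f - 1)], which has degree below [#|V|]. *)
  have -> : \sum_X set_sign R X * (f X == 0)%:R -
      \sum_X set_sign R X * (f X - 1 == 0)%:R = 0; last first.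
    by rewrite addr0 gerBl ler0n.
  rewrite -[RHS](sign_sum0 (sdeg_leD (sdeg_leN df) (sdeg_leN df1)) lt_dn) -sumrB.
  apply: eq_bigr => X _; rewrite -mulrBr; congr (_ * _).
  have := fX X; rewrite negbK mulf_eq0 => /orP[/eqP ->|].
    by rewrite eqxx sub0r oppr_eq0 oner_eq0 /=; ring.
  by rewrite subr_eq0 => /eqP ->; rewrite subrr eqxx oner_eq0 /=; ring.
have leO := card_support_sdeg_le (sdeg_leM df df1) fX; rewrite -/O in leO.
(* The largest [k] with [d + 2k < #|V|]; it leaves at most [d + 1] middle sizes. *)
pose k := ((#|V| - d.+1)./2)%N.
have dk : (d + k.*2 < #|V|)%N by rewrite /k; lia.
have leM := card_middle_layers (leq_ltn_trans (leq_addl d _) dk)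
  (@leq_bin_central #|V|).
have hz := sign_zero_sum_le df dk; have hw := sign_zero_sum_le df1 dk.
set C := 'C(_, _) in leM *; set N := #|_| in leM hz hw *.
(* After squaring and ['C^2 * #|V| <= 4^#|V|], it remains that [4 (d+1)^2 16^d <= 4 * 64^d], which
   follows from [d + 1 <= 2^d]. *)
have leC : (2 * d.+1 * C * 2 ^ (d + d) <= 2 ^ #|V|)%N.
  rewrite -leq_sqr !expnMn -!expnM ![(_ * 2)%N]mulnC !expnM.
  apply: leq_trans (sqr_bin_le #|V| #|V|./2); rewrite -/C mulnAC mulnC leq_mul2l.
  apply/orP; right; apply: leq_trans dn; rewrite -mulnA leq_mul2l /=.
  have -> : (64 = 4 * 16)%N by []; rewrite [in X in (_ <= X)%N]expnMn.
  apply: leq_mul; last by rewrite addnn -mul2n expnM.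
  rewrite -(expnM 2 2) -/(2 ^ 2)%N [(2 * d)%N]mulnC expnM leq_sqr.
  exact: ltn_expl.
have lek : (#|V| - k.*2.+1 <= d.+1)%N by rewrite /k; lia.
have leCO : (2 * (d.+1 * C) <= O)%N.
  by rewrite -(leq_pmul2r (expn_gt0 2 (d + d))) mulnA; apply: leq_trans leO.
(* So [O] is at least twice the bound [2^#|V| - 2N] on each of the two signed sums, and outweighs
   their difference. *)
have : (2 * 2 ^ #|V| <= 4 * N + O)%N.
  have := leq_mul lek (leqnn C); lia.
rewrite -(ler_nat R) natrD !natrM natrX => leNO.
move: hz hw; rewrite !ler_norml => /andP[_ hz] /andP[hw _]; lra.
Qed.

End SetFunctions.

(** * From polynomials to set functions *)

Definition cube_of_set (n : nat) (X : {set 'I_n}) : cube n := [ffun i => i \in X].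

Lemma cube_of_set_bij (n : nat) : bijective (@cube_of_set n).
Proof.
exists (fun x : cube n => [set i | x i]) => [X|x].
  by apply/setP => i; rewrite inE ffunE.
by apply/ffunP => i; rewrite ffunE inE.
Qed.

Lemma par_cube_of_set (n : nat) (X : {set 'I_n}) : par (cube_of_set X) = odd #|X|.
Proof.
rewrite /par modn2 -sum1_card [in RHS]big_mkcond; congr (nat_of_bool (odd _)).
by apply: eq_bigr => i _; rewrite ffunE; case: (i \in X).
Qed.

Section CubeRestriction.
Import mpoly.

(** At 0/1 points positive exponents can be replaced by 1, so a monomial depends only on its set of
    variables, of size at most its degree. *)
Lemma sdeg_le_cube_restr (R : realType) (n : nat) (P : {mpoly R[n]}) :
  sdeg_le (total_degree P) (fun X => cube_restr P (cube_of_set X)).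
Proof.
pose supp (m : 'X_{1..n}) := [set i | m i != 0%N].
have monoE (m : 'X_{1..n}) X :
    \prod_(i < n) ((cube_of_set X i)%:R : R) ^+ m i = (supp m \subset X)%:R.
  have [mX|/subsetPn[i]] := boolP (supp m \subset X).
    apply: big1 => i _; rewrite ffunE; have := subsetP mX i; rewrite inE.
    by case: (m i) => [|k /(_ isT) ->]; rewrite ?expr0 ?expr1n.
  rewrite inE => mi iX; rewrite (bigD1 i) //= ffunE (negbTE iX).
  by rewrite expr0n (negbTE mi) mul0r.
(* [sdeg_le_sum] asks for the bound at every [m]; the guard makes the terms outside the support
   zero. *)
apply: (@eq_sdeg_le _ _ _ (fun X => \sum_(m <- msupp P)
    (if m \in msupp P then P@_m else 0) * (supp m \subset X)%:R)) => [X|].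
  rewrite /cube_restr mevalE; apply: eq_big_seq => m mP.
  by rewrite mP -monoE.
apply: sdeg_le_sum => m; have [mP|mP] := boolP (m \in _); last first.
  by apply: eq_sdeg_le (sdeg_le_cst _ 0) => X; rewrite mul0r.
apply: sdeg_le_monomial.
have := msize_mdeg_lt mP; rewrite /total_degree mdegE.
move=> /(leq_ltn_trans _) lt_size; rewrite -ltnS prednK; last exact: lt_size (leq0n _).
apply: lt_size; rewrite -sum1_card big_mkcond; apply: leq_sum => i _.
by rewrite inE; case: (m i).
Qed.

End CubeRestriction.

(** * The logarithmic degree bound and the conclusion *)

(** For [d > 0], [4 * 64^d <= 256^d], and [ln (256^d) = 8 d ln 2 <= 15 d <= ln n]; [d = 0] is where
    [4 <= n] enters. *)
Lemma exp_le_of_log_bound (R : realType) (n d : nat) :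
    (4 <= n)%N -> 1 <= ln (ln (n%:R : R)) ->
    d%:R <= ln (n%:R : R) / (15 * ln (ln (n%:R : R))) ->
  (4 * 64 ^ d <= n)%N.
Proof.
case: d => [|d] n4 lnln; first by rewrite muln1.
rewrite ler_pdivlMr => [dn|]; last lra.
have n0 : 0 < n%:R :> R by rewrite ltr0n; lia.
suff : (256 ^ d.+1 <= n)%N.
  apply: leq_trans; rewrite !expnS; have := leq_exp2r 64 256 (e := d).
  by case: d {dn} => // d /(_ isT) /=; lia.
rewrite -(ler_nat R) natrX -ler_ln ?posrE ?exprn_gt0 // lnXn //.
have -> : 256%:R = 2 ^+ 8 :> R by rewrite -natrX.
have ln2 : ln (2 : R) <= 1.
  by have := @le_ln1Dx R 1; rewrite -[1 + 1]/(2 : R); apply; lra.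
rewrite lnXn // -[_ *+ d.+1]mulr_natl; apply: le_trans dn.
by rewrite ler_wpM2l // -[_ *+ 8]mulr_natl; lra.
Qed.

Theorem theorem2p3 (R : realType) :
  exists N : nat, forall n : nat, (N <= n)%N ->
  forall P : mpoly.mpoly n R,
    (total_degree P)%:R <= ln (n%:R : R) / (15 * ln (ln (n%:R : R))) ->
    Cor (fun x : cube n => (par x)%:R) (cube_restr P) <= 0.
Proof.
(* Beyond [e^e] the iterated logarithm is at least 1. *)
exists (maxn 4 (Num.truncn (expR (expR 1) : R)).+1) => n.
rewrite geq_max => /andP[n4 nN] P degP.
have en : expR (expR 1) <= n%:R :> R.
  by apply/ltW/(lt_le_trans (truncnS_gt _)); rewrite ler_nat.
have lnln : 1 <= ln (ln (n%:R : R)).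
  have n0 : 0 < n%:R :> R by apply: lt_le_trans en; apply: expR_gt0.
  have e1n : expR 1 <= ln (n%:R : R).
    by rewrite -[X in X <= _]expRK ler_ln // posrE expR_gt0.
  rewrite -[X in X <= _]expRK ler_ln // posrE ?expR_gt0 //.
  by apply: lt_le_trans e1n; apply: expR_gt0.
have := parity_agreement_le (sdeg_le_cube_restr P).
rewrite card_ord => /(_ (exp_le_of_log_bound n4 lnln degP)).
rewrite /Cor /unif_prob subr_le0 card_ffun card_bool card_ord.
rewrite -[X in (2 * X)%N](card_imset _ (bij_inj (@cube_of_set_bij n))).
set B := imset _ _; set A := [set x : cube n | _].
have -> : B = A.
  have [g gK Kg] := @cube_of_set_bij n.
  apply/setP => x; rewrite inE -[x]Kg mem_imset ?inE; last exact: can_inj gK.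
  by rewrite par_cube_of_set eq_sym.
rewrite -(ler_nat R) natrM => le2; rewrite ler_pdivrMr ?ltr0n ?expn_gt0 //.
by rewrite -ler_pdivrMl ?invr_gt0 // invrK.
Qed.
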